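(* Let $m$ be a nonnegative integer and let $T_m(x)$ be the $m$-th Chebyshev polynomial of the first kind. Then $T_m(x) \in \mathcal{P}$; that is, there are infinitely many positive integers $n$ such that $T_m(n) \mid n!$.
   Context: $\mathcal{P}$ denotes the set of polynomials $P(x)$ with integer coefficients such that $P(n) \mid n!$ for infinitely many positive integers $n$ (divisibility in $\mathbb{Z}$). The Chebyshev polynomials of the first kind are defined by $T_0(x) = 1$, $T_1(x) = x$, and $T_{n+1}(x) = 2xT_n(x) - T_{n-1}(x)$ for $n \ge 1$. *)

(* Defs.v *)
From HB Require Import structures.
From mathcomp Require Import all_boot all_order all_algebra.

Set Implicit Arguments.
Unset Strict Implicit.
Unset Printing Implicit Defensive.

Import Order.TTheory GRing.Theory Num.Theory.
Local Open Scope ring_scope.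

Fixpoint chebyshevT (m : nat) : {poly int} :=
  match m with
  | 0%N => 1
  | 1%N => 'X
  | (k.+1 as k1).+1 => 2%:R *: 'X * chebyshevT k1 - chebyshevT k
  end.

(* Infinitely many n is rendered as arbitrarily large n; divisibility is
   in Z, so 0 divides only 0. *)
Definition infinitely_often_divides_fact (P : {poly int}) : Prop :=
  forall N : nat, exists n : nat,
    [/\ (0 < n)%N, (N <= n)%N & (P.[n%:Z] %| (n`!)%:Z)%Z].

(* Main.v *)
Require Import Defs.
From HB Require Import structures.
From mathcomp Require Import all_boot all_order all_algebra.
From mathcomp Require Import cyclic algC cyclotomic.
From mathcomp Require Import zify ring.

(** The witnesses are n = T_k(t) for a suitable fixed k and all large t.  Since
    T_m(T_k(t)) = T_{mk}(t) ([chebyshevT_comp]), the value to be studied is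
    T_N(t) with N = mk, and it splits into small factors.

    Write t = (a + b) / 2 with ab = 1, so that 2 T_N(t) = a^N + b^N
    ([chebyshevT_cosh]).  The polynomial X^(2N) + 1 is the product of the
    cyclotomic polynomials Phi_d over the d that divide 4N but not 2N.  For such
    d > 2, Phi_d is reciprocal of even degree, so a^(- totient d / 2) Phi_d(a)
    is symmetric in a and b; it is an integer u_d, an integral combination of the
    T_j(t) with j <= totient d / 2 ([cyclotomic_coshE]).  Hence 2 T_N(t) is the
    product of the u_d ([chebyshevT_cyclotomic]).

    The integer k is chosen with 2m totient(k) < k ([totient_ratio_small]), which
    forces totient d / 2 < k for every d dividing 4mk.  Then each |u_d| is at most
    a constant times T_{k-1}(t), while T_k(t) >= t T_{k-1}(t): for t large the sum
    of the |u_d| is at most n = T_k(t).  Nonzero integers whose absolute values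
    add up to at most n have a product that divides n!, by integrality of
    multinomial coefficients ([dvdz_prod_fact]).

    Ratios totient(k) / k are arbitrarily small because d totient(M) <=
    M totient(d) for d | M; summing over the d = M / i with i <= 2^r, where
    M = (2^r)!, bounds totient(M) / M by the inverse of a partial sum of the
    harmonic series. *)

Set Implicit Arguments.
Unset Strict Implicit.
Unset Printing Implicit Defensive.

(** * Integers with small totient ratio *)

Lemma big_uniq_subset (R : Type) (idx : R) (op : Monoid.com_law idx)
    (I : eqType) (r s : seq I) (F : I -> R) :
    uniq r -> uniq s -> {subset s <= r} ->
  \big[op/idx]_(i <- r) F i =
    op (\big[op/idx]_(i <- s) F i) (\big[op/idx]_(i <- r | i \notin s) F i).
Proof.
move=> Ur Us sr; rewrite (bigID (mem s)) /=; congr (op _ _).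
rewrite -big_filter; apply: perm_big; apply: uniq_perm; rewrite ?filter_uniq //.
by move=> x; rewrite mem_filter; case: (boolP (x \in s)) => // /sr ->.
Qed.

(** Coprimality to b has period b, so each of the a blocks of length b contains
    totient b such residues. *)
Lemma sum_coprime_period a b :
  \sum_(0 <= i < a * b) coprime b i = a * totient b.
Proof.
elim: a => [|a IHa]; first by rewrite !mul0n big_geq.
rewrite !mulSn addnC (@big_cat_nat _ _ _ (a * b)) ?leq_addr //= IHa addnC.
congr (_ + _); rewrite -{1}[a * b]add0n big_addn addnC addnK.
rewrite totient_count_coprime; apply: eq_bigr => i _.
by rewrite /coprime addnC gcdnMDl.
Qed.

(** An integer coprime to a * b is in particular coprime to b. *)
Lemma totient_mul_le a b : totient (a * b) <= a * totient b.
Proof.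
rewrite -sum_coprime_period totient_count_coprime; apply: leq_sum => i _.
by rewrite coprimeMl; case: (coprime a i).
Qed.

(** In the product formula for the totient, passing from d to a multiple n only
    adds primes and raises exponents. *)
Lemma totient_dvd_le d n : 0 < n -> d %| n -> totient d <= totient n.
Proof.
move=> n_gt0 dn; have d_gt0 := dvdn_gt0 n_gt0 dn.
rewrite !totientE // (big_uniq_subset _ _ (primes_uniq n) (primes_uniq d)); last first.
  by move=> p; rewrite !mem_primes n_gt0 => /and3P[-> _ /dvdn_trans->].
rewrite -[leqLHS]muln1 leq_mul //.
  apply: leq_prod => -[|p] _; first by rewrite !mul0n.
  by rewrite leq_mul // leq_pexp2l // -!subn1 leq_sub2r // dvdn_leq_log.
rewrite big_seq_cond prodn_cond_gt0 // => p /andP[+ _]; rewrite mem_primes.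
by case/and3P=> /prime_gt1 p_gt1 _ _; rewrite muln_gt0 expn_gt0; lia.
Qed.

Lemma sum_totient n : 0 < n -> \sum_(d <- divisors n) totient d = n.
Proof.
move=> n_gt0; rewrite -[RHS]sum_totient_dvd.
rewrite -(big_mkord (fun d => d %| n)) -[RHS]big_filter; apply: perm_big.
apply: uniq_perm; rewrite ?divisors_uniq ?filter_uniq ?iota_uniq // => d.
rewrite mem_filter mem_index_iota -dvdn_divisors //.
by case: (boolP (d %| n)) => // /(dvdn_leq n_gt0); rewrite ltnS => ->.
Qed.

(** The dyadic bound for the harmonic series, scaled by a common multiple M so
    that every quotient is exact: the i in ]2^r, 2^(r+1)] contribute at least
    2^r * (M / 2^(r+1)) = M / 2. *)
Lemma harmonic_sum_ge r M :
  (forall i, 0 < i <= 2 ^ r -> i %| M) ->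
  r * M <= 2 * \sum_(1 <= i < (2 ^ r).+1) M %/ i.
Proof.
elim: r => [|r IHr] dvM; first by rewrite mul0n.
have le2 : 2 ^ r <= 2 ^ r.+1 by rewrite leq_exp2l.
rewrite (@big_cat_nat _ _ _ (2 ^ r).+1) //= mulnDr mulSn addnC leq_add //.
  by apply: IHr => i /andP[i0 le]; apply: dvM; rewrite i0 (leq_trans le).
have /divnK {1}<- : 2 ^ r.+1 %| M by apply: dvM; rewrite expn_gt0 /=.
rewrite mulnC {1}expnS -mulnA leq_mul //.
apply: (@leq_trans (\sum_((2 ^ r).+1 <= i < (2 ^ r.+1).+1) M %/ 2 ^ r.+1)).
  by rewrite sum_nat_const_nat expnS; lia.
rewrite [X in _ <= X]big_nat [X in X <= _]big_nat; apply: leq_sum => i /andP[lo hi].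
by rewrite leq_div2l //; lia.
Qed.

(** Summing (M / i) totient(M) <= M totient(M / i) over i <= 2^r, and using that
    the totients of the divisors of M add up to M, gives
    totient(M) * (M/1 + ... + M/2^r) <= M^2, and the second factor exceeds any
    given multiple of M. *)
Lemma totient_ratio_small C : exists2 M, 0 < M & C * totient M < M.
Proof.
(* The harmonic bound yields r * totient M <= 2 * M, hence the strict inequality
   as soon as r > 2 * C. *)
pose r := (2 * C).+1; pose M := (2 ^ r)`!; exists M; first exact: fact_gt0.
have M_gt0 : 0 < M by apply: fact_gt0.
have dvM i : 0 < i <= 2 ^ r -> i %| M by apply: dvdn_fact.
pose s := [seq M %/ i | i <- index_iota 1 (2 ^ r).+1].
have sum_le : totient M * (\sum_(1 <= i < (2 ^ r).+1) M %/ i) <= M * M.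
  have Us : uniq s.
    rewrite map_inj_in_uniq ?iota_uniq // => i j.
    rewrite !mem_index_iota => /dvM/divnK Ei /dvM/divnK Ej Eij.
    have Q : 0 < M %/ i by case: (M %/ i) Ei M_gt0 => // <-.
    by apply/eqP; rewrite -(eqn_pmul2l Q) {2}Eij Ei Ej.
  have sD : {subset s <= divisors M}.
    move=> _ /mapP[i /[!mem_index_iota] /dvM/divnK Ei ->].
    by rewrite -dvdn_divisors //; apply/dvdnP; exists i; rewrite mulnC Ei.
  rewrite -[X in _ <= M * X](sum_totient M_gt0).
  rewrite (big_uniq_subset _ _ (divisors_uniq M) Us sD) mulnDr -[leqLHS]addn0.
  rewrite leq_add // big_map !big_distrr /= [X in _ <= X]big_nat [X in X <= _]big_nat.
  apply: leq_sum => i /dvM/divnK Ei.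
  rewrite -{1 3}Ei mulnC -mulnA leq_mul2l; apply/orP; right.
  by rewrite mulnC; exact: totient_mul_le.
have := harmonic_sum_ge dvM.
move: (\sum_(1 <= i < (2 ^ r).+1) M %/ i) sum_le => S le1 le2.
have T_gt0 : 0 < totient M by rewrite totient_gt0.
have : r * totient M <= 2 * M.
  rewrite -(leq_pmul2l M_gt0).
  have {}le2 := leq_mul (leqnn (totient M)) le2.
  lia.
by rewrite /r; lia.
Qed.

Import Order.TTheory GRing.Theory Num.Theory.
Local Open Scope ring_scope.

(** * Chebyshev polynomials as hyperbolic cosines *)

Lemma chebyshevT_recE k (t : int) :
  (chebyshevT k.+2).[t] =
    2 * t * (chebyshevT k.+1).[t] - (chebyshevT k).[t].
Proof. by rewrite [chebyshevT _]/= !hornerE. Qed.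

(** With a = exp u and b = exp (- u), this is T_j(cosh u) = cosh (j u), stated
    without division. *)
Lemma chebyshevT_cosh (R : comNzRingType) (a b : R) (t : int) j :
  a * b = 1 -> a + b = 2 * t%:~R ->
  2 * (chebyshevT j).[t]%:~R = a ^+ j + b ^+ j.
Proof.
move=> ab1 abt.
suff [] : 2 * (chebyshevT j).[t]%:~R = a ^+ j + b ^+ j /\
          2 * (chebyshevT j.+1).[t]%:~R = a ^+ j.+1 + b ^+ j.+1 by [].
elim: j => [|j [IH0 IH1]].
  by rewrite /= !hornerE /= !expr0 !expr1; split=> //; ring.
split=> //; rewrite chebyshevT_recE rmorphB !rmorphM /= mulrBr IH0.
rewrite mulrCA IH1 (_ : 2%:~R = 2 :> R) // -abt.
transitivity (a ^+ j.+2 + b ^+ j.+2 + (a * b - 1) * (a ^+ j + b ^+ j)).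
  by rewrite !exprS; ring.
by rewrite ab1 subrr mul0r addr0.
Qed.

Lemma cosh_parameter (t : int) :
  exists a b : algC, a * b = 1 /\ a + b = 2 * t%:~R.
Proof.
pose s : algC := sqrtC (t%:~R ^+ 2 - 1).
exists (t%:~R + s), (t%:~R - s); split; last by ring.
by rewrite mulrC -subr_sqr sqrtCK; ring.
Qed.

(** If a, b parametrize t then a^k, b^k parametrize T_k(t). *)
Lemma chebyshevT_comp m k (t : int) :
  (chebyshevT m).[(chebyshevT k).[t]] = (chebyshevT (m * k)).[t].
Proof.
have [a [b [ab1 abt]]] := cosh_parameter t.
apply: (@intr_inj algC); apply: (@mulfI _ 2); first by rewrite pnatr_eq0.
rewrite (chebyshevT_cosh (m * k) ab1 abt).
rewrite (@chebyshevT_cosh _ (a ^+ k) (b ^+ k)); first by rewrite -!exprM mulnC.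
  by rewrite -exprMn ab1 expr1n.
by rewrite (chebyshevT_cosh k ab1 abt).
Qed.

(** Both bounds have to be proved together: T_(j+2) = 2 t T_(j+1) - T_j, and the
    subtracted term is absorbed by T_j <= t T_j <= T_(j+1) <= t T_(j+1). *)
Lemma chebyshevT_growth (t : int) j : 1 <= t ->
  1 <= (chebyshevT j).[t] /\ t * (chebyshevT j).[t] <= (chebyshevT j.+1).[t].
Proof.
move=> t1; elim: j => [|j [IH0 IH1]]; first by rewrite /= !hornerE.
rewrite chebyshevT_recE; move: IH0 IH1.
move: ((chebyshevT j).[t]) ((chebyshevT j.+1).[t]) => x y x1 xy; split; nia.
Qed.

Lemma chebyshevT_homo (t : int) i j : 1 <= t -> (i <= j)%N ->
  (chebyshevT i).[t] <= (chebyshevT j).[t].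
Proof.
move=> t1 /subnKC<-; elim: (_ - _)%N => [|d IHd]; first by rewrite addn0.
rewrite addnS; have [] := chebyshevT_growth (i + d) t1; nia.
Qed.

(** * Cyclotomic polynomials are reciprocal *)

Local Notation pZtoC := (map_poly (intr : int -> algC)).

Lemma root_Cyclotomic n (x : algC) : (0 < n)%N ->
  root (pZtoC (Cyclotomic n)) x = n.-primitive_root x.
Proof.
move=> n_gt0; have [z zP] := C_prim_root_exists n_gt0.
by rewrite (Cintr_Cyclotomic zP) root_cyclotomic.
Qed.

(** Inversion permutes the primitive n-th roots of unity, so reversing Phi_n
    multiplies it by a constant c; since Phi_n(1) <> 0 for n > 1, evaluation at 1
    gives c = 1. *)
Lemma Cyclotomic_reciprocal n (x y : algC) : (1 < n)%N -> x * y = 1 ->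
  x ^+ totient n * (pZtoC (Cyclotomic n)).[y] = (pZtoC (Cyclotomic n)).[x].
Proof.
move=> n_gt1 xy1; have [z zP] := C_prim_root_exists (ltnW n_gt1).
have z_nz : z != 0 by rewrite (prim_root_eq0 zP) gtn_eqF // ltnW.
have zVP : n.-primitive_root z^-1.
  have -> : z^-1 = z ^+ n.-1.
    apply: (mulfI z_nz); rewrite divff ?z_nz //.
    by rewrite -exprS prednK ?(ltnW n_gt1) // (prim_expr_order zP).
  by rewrite prim_root_exp_coprime // coprimePn // ltnW.
pose c := \prod_(k < n | coprime k n) (- z ^+ k).
have eqc u v : u * v = 1 -> u ^+ totient n * (pZtoC (Cyclotomic n)).[v] =
                     c * (pZtoC (Cyclotomic n)).[u].
  move=> uv1; rewrite {1}(Cintr_Cyclotomic zP) (Cintr_Cyclotomic zVP).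
  rewrite /cyclotomic !horner_prod -big_split /=.
  have -> : u ^+ totient n = \prod_(k < n | coprime k n) u.
    rewrite prodr_const; congr (_ ^+ _).
    rewrite totient_count_coprime -big_mkcond big_mkord -sum1_card.
    by apply: eq_bigl => k; rewrite coprime_sym.
  rewrite -big_split /=; apply: eq_bigr => k _.
  have zzV : z ^+ k * z^-1 ^+ k = 1 by rewrite -exprMn divff ?expr1n.
  by rewrite !hornerE mulrBr uv1 -zzV; ring.
rewrite eqc // (_ : c = 1) ?mul1r //.
have nz1 : (pZtoC (Cyclotomic n)).[1] != 0.
  rewrite -[_ == 0]/(root _ _) root_Cyclotomic ?(ltnW n_gt1) //.
  apply/negP=> p1; have := prim_order_dvd p1 1; rewrite expr1n eqxx dvdn1.
  by apply/negP; rewrite gtn_eqF.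
by apply: (mulIf nz1); rewrite -(eqc 1 1 (mulr1 1)) expr1n.
Qed.

(** A reciprocal polynomial of odd degree vanishes at -1, but -1 is not a
    primitive n-th root of unity when n > 2. *)
Lemma totient_even n : (2 < n)%N -> ~~ odd (totient n).
Proof.
move=> n_gt2; have m1K : (-1) * (-1) = 1 :> algC by rewrite mulrNN mulr1.
have := Cyclotomic_reciprocal (ltnW n_gt2) m1K.
have nz : (pZtoC (Cyclotomic n)).[-1] != 0.
  rewrite -[_ == 0]/(root _ _) root_Cyclotomic; last by lia.
  apply/negP=> p1; have := prim_order_dvd p1 2; rewrite sqrrN expr1n eqxx.
  by move/dvdn_leq => /(_ isT); rewrite leqNgt n_gt2.
rewrite -[RHS]mul1r => /(mulIf nz); rewrite -signr_odd.
case: odd => // /eqP; rewrite expr1 eq_sym -subr_eq0 opprK -[1 + 1]/(2%:R).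
by rewrite pnatr_eq0.
Qed.

(** * Factorization of Chebyshev values *)

(** For n > 2, the value a^(-e) Phi_n(a), with 2e = totient n and a + 1/a = 2t: the
    average of a^(-e) Phi_n(a) and a^e Phi_n(1/a) replaces each a^(i - e) by
    T_|i - e|(t).  The distance |i - e| is written as a sum of two truncated
    differences, one of which is zero. *)
Definition cyclotomic_cosh n (t : int) : int :=
  let e := (totient n)./2 in
  \sum_(i < size (Cyclotomic n))
    (Cyclotomic n)`_i * (chebyshevT ((i - e) + (e - i))).[t].

(** With totient n = 2e, reciprocity writes 2 Phi_n(a) as
    Phi_n(a) + a^(2e) Phi_n(b), whose i-th terms add up to the i-th coefficient
    times a^i + a^(2e - i) = a^e * 2 T_|i - e|(t). *)
Lemma cyclotomic_coshE n (t : int) (a b : algC) : (2 < n)%N ->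
  a * b = 1 -> a + b = 2 * t%:~R ->
  (cyclotomic_cosh n t)%:~R * a ^+ (totient n)./2 = (pZtoC (Cyclotomic n)).[a].
Proof.
move=> n_gt2 ab1 abt; apply: (@mulfI _ 2); first by rewrite pnatr_eq0.
have e2 : totient n = (totient n)./2.*2.
  by rewrite even_halfK // totient_even.
rewrite [RHS]mulr_natl mulr2n.
rewrite -[in X in _ = _ + X](Cyclotomic_reciprocal (ltnW n_gt2) ab1).
rewrite !horner_coef size_map_inj_poly ?rmorph0 //; last exact: intr_inj.
rewrite rmorph_sum mulr_suml !mulr_sumr -big_split /=.
apply: eq_bigr => -[i /= i_le] _; rewrite coef_map /= rmorphM /=.
rewrite size_Cyclotomic ltnS in i_le.
set e := (totient n)./2 in e2 *.
transitivity (((Cyclotomic n)`_i)%:~R *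
              (2 * (chebyshevT (i - e + (e - i))).[t]%:~R * a ^+ e)).
  by ring.
rewrite (chebyshevT_cosh _ ab1 abt) mulrDl.
have shift p q r : (p + r = q)%N -> b ^+ p * a ^+ q = a ^+ r.
  by move=> <-; rewrite exprD mulrA -exprMn [b * a]mulrC ab1 expr1n mul1r.
rewrite [a ^+ totient n * _]mulrCA -mulrDr; congr (_ * _).
rewrite [_ * b ^+ i]mulrC (shift i (totient n) (totient n - i)%N) ?subnKC // -exprD.
case: (leqP i e) => ie.
  rewrite (shift _ _ i) ?addnE; last by lia.
  by rewrite addrC; congr (_ + a ^+ _); lia.
rewrite (shift _ _ (totient n - i)%N); last by lia.
by congr (a ^+ _ + _); lia.
Qed.

Lemma cyclotomic_cosh_le n (t : int) k : 1 <= t -> ((totient n)./2 <= k)%N ->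
  (2 < n)%N ->
  `|cyclotomic_cosh n t| <=
    (\sum_(i < size (Cyclotomic n)) `|(Cyclotomic n)`_i|) * (chebyshevT k).[t].
Proof.
move=> t1 ek n_gt2; apply: le_trans (ler_norm_sum _ _ _) _.
rewrite mulr_suml; apply: ler_sum => -[i /= i_le] _; rewrite normrM.
rewrite size_Cyclotomic ltnS in i_le.
have e2 := even_halfK (totient_even n_gt2).
have [T1 _] := chebyshevT_growth (i - (totient n)./2 + ((totient n)./2 - i)) t1.
rewrite (ger0_norm (le_trans _ T1)) // ler_wpM2l // chebyshevT_homo //.
by lia.
Qed.

(** Both 1 and 2 divide 2 * N. *)
Lemma divisor_dbl_gt2 N d : (0 < N)%N ->
  d \in divisors (4 * N) -> d \notin divisors (2 * N) -> (2 < d)%N.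
Proof.
move=> N_gt0; rewrite -!dvdn_divisors ?muln_gt0 //.
case: d => [|[|[|d]]] //; rewrite ?dvd1n ?(dvdn_mulr N (dvdnn 2)) //.
by rewrite dvd0n; lia.
Qed.

(** Multiplied by a^N, the left side is a^(2N) + 1 and the right side is the
    product of the Phi_d(a), because the half degrees of these Phi_d add up to N. *)
Lemma chebyshevT_cyclotomic N (t : int) : (0 < N)%N ->
  2 * (chebyshevT N).[t] =
    \prod_(d <- divisors (4 * N) | d \notin divisors (2 * N)) cyclotomic_cosh d t.
Proof.
move=> N_gt0; have N2_gt0 : (0 < 2 * N)%N by lia.
have N4_gt0 : (0 < 4 * N)%N by lia.
have sub : {subset divisors (2 * N) <= divisors (4 * N)}.
  move=> d; rewrite -!dvdn_divisors // => /dvdn_trans; apply.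
  by apply/dvdnP; exists 2; lia.
have gt2 := divisor_dbl_gt2 N_gt0.
(* X^(4N) - 1 = (X^(2N) - 1) (X^(2N) + 1). *)
have prodPhi : \prod_(d <- divisors (4 * N) | d \notin divisors (2 * N)) Cyclotomic d
             = 'X^(2 * N) + 1.
  have nz : 'X^(2 * N) - 1 != 0 :> {poly int}.
    by rewrite -size_poly_eq0 size_XnsubC.
  apply: (mulfI nz); rewrite -subr_sqr expr1n -exprM.
  rewrite -prod_Cyclotomic //.
  rewrite -(big_uniq_subset _ _ (divisors_uniq _) (divisors_uniq _) sub).
  by rewrite prod_Cyclotomic //; congr ('X^_ - 1); lia.
have sumphi : (\sum_(d <- divisors (4 * N) | d \notin divisors (2 * N))
     (totient d)./2 = N)%N.
  apply: double_inj; apply: (@addnI (2 * N)).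
  transitivity (4 * N)%N; last by lia.
  rewrite -[RHS](sum_totient N4_gt0).
  rewrite (big_uniq_subset _ _ (divisors_uniq _) (divisors_uniq _) sub) /=.
  rewrite (sum_totient N2_gt0) -muln2 big_distrl /=; congr (_ + _)%N.
  rewrite big_seq_cond [RHS]big_seq_cond; apply: eq_bigr => d /andP[d4 d2].
  by rewrite muln2 even_halfK // totient_even // gt2.
have [a [b [ab1 abt]]] := cosh_parameter t.
have a_nz : a != 0.
  by apply: contraTneq (oner_neq0 algC) => a0; rewrite -ab1 a0 mul0r eqxx.
apply: (@intr_inj algC); apply: (@mulIf _ (a ^+ N)); first by rewrite expf_neq0.
transitivity ((pZtoC ('X^(2 * N) + 1)).[a]).
  rewrite rmorphM /= (chebyshevT_cosh _ ab1 abt) mulrDl.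
  rewrite -[b ^+ N * _]exprMn [b * a]mulrC ab1 expr1n.
  by rewrite -exprD rmorphD /= map_polyXn rmorph1 !hornerE addnn mul2n.
rewrite -prodPhi rmorph_prod horner_prod rmorph_prod -[in a ^+ N]sumphi expr_sum.
rewrite -big_split /= big_seq_cond [RHS]big_seq_cond.
by apply: eq_bigr => d /andP[d4 d2]; rewrite (cyclotomic_coshE _ ab1 abt) ?gt2.
Qed.

(** * Divisibility of factorials *)

(** Each factor F i divides `|F i|!, and a multinomial coefficient is an
    integer; the factors need not be distinct. *)
Lemma dvdz_prod_fact (I : Type) (r : seq I) (F : I -> int) (n : nat) :
  \prod_(i <- r) F i != 0 -> \sum_(i <- r) `|F i| <= n%:Z ->
  (\prod_(i <- r) F i %| (n`!)%:Z)%Z.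
Proof.
elim: r n => [|x r IHr] n; first by rewrite !big_nil dvd1z.
rewrite !big_cons mulf_eq0 negb_or => /andP[Fx_nz prod_nz] sum_le.
have sum_ge0 : 0 <= \sum_(i <- r) `|F i| by apply: sumr_ge0.
have Fx_le : (`|F x| <= n)%N.
  by rewrite -lez_nat abszE (le_trans _ sum_le) // lerDl.
rewrite -(bin_fact Fx_le) !PoszM; apply: dvdz_mull; apply: dvdz_mul.
  by rewrite dvdzE /= dvdn_fact // absz_gt0 Fx_nz leqnn.
by apply: IHr => //; rewrite -subzn // abszE lerBrDl.
Qed.

Theorem theorem3p8 (m : nat) : infinitely_often_divides_fact (chebyshevT m).
Proof.
move=> N; case: m => [|m'].
  (* T_0 = 1; the general argument requires m * k > 0. *)
  by exists N.+1; split; rewrite //= hornerE dvd1z.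
set m := m'.+1.
have [k k_gt0 k_small] := totient_ratio_small (2 * m).
have mk_gt0 : (0 < m * k)%N by rewrite muln_gt0.
pose D := [seq d <- divisors (4 * (m * k)) | d \notin divisors (2 * (m * k))].
pose B : int := \sum_(d <- D) \sum_(i < size (Cyclotomic d)) `|(Cyclotomic d)`_i|.
have B_ge0 : 0 <= B by apply: sumr_ge0 => d _; apply: sumr_ge0.
(* B bounds all the factors together by B * T_(k-1)(t); t >= B makes this at most
   T_k(t), and t > N makes the witness T_k(t) exceed N. *)
pose t : int := B + N.+1%:Z.
have t1 : 1 <= t by rewrite /t; lia.
have [S1 S2] := chebyshevT_growth k.-1 t1; rewrite prednK // in S2.
have [n def_n] : exists n : nat, (chebyshevT k).[t] = n%:Z.
  by exists `|(chebyshevT k).[t]|%N; rewrite gez0_abs //; nia.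
have t_le : t <= n%:Z by rewrite -def_n; nia.
exists n; split; [lia | lia |].
rewrite -def_n chebyshevT_comp.
apply: (@dvdz_trans (2 * (chebyshevT (m * k)).[t])); first exact: dvdz_mull.
have [T1 _] := chebyshevT_growth (m * k) t1.
have := chebyshevT_cyclotomic t mk_gt0; rewrite -big_filter -/D => prodE.
rewrite prodE; apply: dvdz_prod_fact; first by rewrite -prodE; lia.
rewrite -def_n; apply: le_trans S2.
apply: (@le_trans _ _ (B * (chebyshevT k.-1).[t])); last first.
  by rewrite ler_wpM2r ?lerDl // (le_trans _ S1).
rewrite /B mulr_suml big_seq [X in _ <= X]big_seq; apply: ler_sum => d.
rewrite mem_filter => /andP[d2 d4].
apply: cyclotomic_cosh_le => //; last exact: divisor_dbl_gt2 d4 d2.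
rewrite -dvdn_divisors ?muln_gt0 // in d4.
(* totient d <= totient (4mk) <= 4m * totient k < 2k. *)
have := totient_dvd_le _ d4; rewrite muln_gt0 /= => /(_ mk_gt0).
have := totient_mul_le (4 * m) k; rewrite -mulnA.
lia.
Qed.
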